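(* There exist trees $T$ of diameter $4$ for which the bandwidth $B(T)$ is strictly greater than the local density $\beta(T)$.
   Context: For an injection $f\colon V(G)\to\mathbb{Z}$, its bandwidth is $B(f)=\max_{uv\in E(G)}|f(u)-f(v)|$; the bandwidth of $G$ is $B(G)=\min_f B(f)$ over all such injections. Writing $n(H)=|V(H)|$, the local density of $G$ is $\beta(G)=\max_{H}\lceil (n(H)-1)/\operatorname{diam} H\rceil$, the maximum over connected subgraphs $H\subseteq G$ with at least two vertices. *)

(* Defs.v *)
From HB Require Import structures.
From mathcomp Require Import all_boot all_order all_algebra.
From mathcomp Require Import boolp.

Set Implicit Arguments.
Unset Strict Implicit.
Unset Printing Implicit Defensive.

(* Finite simple graphs. *)
Record sgraph := SGraph {
  vert :> finType;
  adj : rel vert;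
  adj_sym : symmetric adj;
  adj_irr : irreflexive adj
}.

Definition connected (G : sgraph) : bool :=
  (0 < #|{: G}|) && [forall x : G, forall y : G, connect (@adj G) x y].

(* [ucycle] also accepts the empty sequence and, since [adj] is symmetric, any
   pair of adjacent vertices; genuine cycles have at least three vertices. *)
Definition acyclic (G : sgraph) : Prop :=
  forall c : seq G, ucycle (@adj G) c -> size c <= 2.

Definition tree (G : sgraph) : Prop := connected G /\ acyclic G.

(* Least number of edges of a walk from x to y. A shortest walk has fewer than
   #|G| edges; the value is the dummy #|G| when y is not reachable from x. *)
Definition dist (G : sgraph) (x y : G) : nat :=
  find (fun n => [exists p : n.-tuple G, path (@adj G) x p && (last x p == y)])
       (iota 0 #|{: G}|).

(* Only meaningful when G is connected. *)
Definition diam (G : sgraph) : nat := \max_(x : G) \max_(y : G) dist x y.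

Definition edge_span (G : sgraph) (f : G -> int) : nat :=
  \max_(u : G) \max_(v : G | adj u v) `|(f u - f v)%R|%N.

Lemma edge_span_exists (G : sgraph) :
  exists b, `[< exists f : G -> int, injective f /\ edge_span f = b >].
Proof.
pose f (x : G) : int := Posz (enum_rank x).
exists (edge_span f); apply/asboolP; exists f; split=> // x y [].
by move/ord_inj/enum_rank_inj.
Qed.

Definition bandwidth (G : sgraph) : nat := ex_minn (edge_span_exists G).

(* A subgraph, not necessarily induced, is a set S of vertices together with a
   symmetric set F of ordered pairs, one pair in each direction per edge. *)
Definition is_subgraph (G : sgraph) (SF : {set G} * {set G * G}) : bool :=
  [forall x : G, forall y : G, ((x, y) \in SF.2) ==>
    [&& adj x y, x \in SF.1, y \in SF.1 & (y, x) \in SF.2]].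

Definition subgraph (G : sgraph) := {SF | @is_subgraph G SF}.

Section SubgraphAsGraph.
Variables (G : sgraph) (H : subgraph G).

Definition sub_vert : finType := {x : G | x \in (val H).1}.

Definition sub_adj : rel sub_vert :=
  fun x y => (val x, val y) \in (val H).2.

Lemma sub_adjP (x y : sub_vert) :
  sub_adj x y -> adj (val x) (val y) /\ sub_adj y x.
Proof.
move=> xy; have /forallP/(_ (val x))/forallP/(_ (val y))/implyP := valP H.
by case/(_ xy)/and4P.
Qed.

Lemma sub_adj_sym : symmetric sub_adj.
Proof. by move=> x y; apply/idP/idP=> /sub_adjP[]. Qed.

Lemma sub_adj_irr : irreflexive sub_adj.
Proof. by move=> x; apply/negP=> /sub_adjP[]; rewrite adj_irr. Qed.

Definition graph_of_subgraph : sgraph := SGraph sub_adj_sym sub_adj_irr.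

End SubgraphAsGraph.

Coercion graph_of_subgraph : subgraph >-> sgraph.

(* A connected H with at least two vertices has 0 < diam H, so each quotient is
   an honest division and its ceiling is a natural number. *)
Definition local_density (G : sgraph) : nat :=
  \max_(H : subgraph G | connected H && (1 < #|{: H}|))
    `|Num.ceil ((#|{: H}| - 1)%:R / (diam H)%:R : rat)%R|%N.

(* Main.v *)
(* The tree T has a root with six children, three of which have two leaf
   children each, so 13 vertices. A subgraph of diameter k lies in the ball of
   radius k around each of its vertices, and the sizes of these balls give local
   density at most 3. If f had bandwidth at most 3 and sent the root to 0, the
   root and its children would fill [-3, 3], so all six remaining leaves would
   lie beyond, on the same side of 0 as their parent. Two of the three parents
   are on one side, and then four leaves compete for three positions. *)
Require Import Defs.
From mathcomp Require Import all_boot all_order all_algebra.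
From mathcomp Require Import boolp zify.

Set Implicit Arguments.
Unset Strict Implicit.
Unset Printing Implicit Defensive.

Import Order.TTheory GRing.Theory Num.Theory.

(** * Walks, distances and computable balls *)

Lemma dist_le_walk (G : sgraph) (x : G) (p : seq G) :
  path (@adj G) x p -> dist x (last x p) <= size p.
Proof.
move=> xp; rewrite leqNgt; apply/negP => lt_p.
(* Even its dummy value keeps [dist] within [#|G|], so the length of [p] is among the candidates
   searched. *)
have lt_G : size p < #|{: G}|.
  by apply: leq_trans lt_p _; rewrite -[X in _ <= X](size_iota 0) find_size.
have := before_find 0 lt_p; rewrite nth_iota // add0n => /existsP[].
by exists (in_tuple p); rewrite xp eqxx.
Qed.

(** Shortening a walk to a repetition-free one brings its length below [#|G|], so the search in
    [dist] succeeds. *)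
Lemma dist_walk (G : sgraph) (x y : G) : connect (@adj G) x y ->
  exists p, [/\ path (@adj G) x p, last x p = y & size p = dist x y].
Proof.
case/connectP=> p0 /shortenP[p xp Up _] ->{y}.
have lt_G : size p < #|{: G}|.
  by rewrite -[(size p).+1]/(size (x :: p)) -(card_uniqP Up) max_card.
have : has (fun n => [exists q : n.-tuple G,
    path (@adj G) x q && (last x q == last x p)]) (iota 0 #|{: G}|).
  apply/hasP; exists (size p); first by rewrite mem_iota.
  by apply/existsP; exists (in_tuple p); rewrite xp eqxx.
move=> hasP0; have := nth_find 0 hasP0; move: hasP0; rewrite has_find size_iota.
rewrite -/(dist x (last x p)) => lt_d; rewrite nth_iota // add0n.
by case/existsP=> q /andP[xq /eqP lq]; exists q; rewrite size_tuple.
Qed.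

Section Balls.

Variable nbrs : nat -> seq nat.

(** Balls are lists of plain numbers so that they can be evaluated. *)
Fixpoint ball (k x : nat) : seq nat :=
  if k is k'.+1 then undup (ball k' x ++ flatten (map nbrs (ball k' x)))
  else [:: x].

Lemma sub_ball (j k x : nat) : j <= k -> {subset ball j x <= ball k x}.
Proof.
elim: k => [|k IHk]; first by rewrite leqn0 => /eqP->.
rewrite leq_eqVlt => /predU1P[-> //|/IHk sub y /sub yk].
by rewrite /= mem_undup mem_cat yk.
Qed.

(** The labelling [h] lets one neighbour table serve both [T] and its subgraphs, whose edges are
    edges of [T]. *)
Lemma mem_ball_dist (G : sgraph) (h : G -> nat) (x y : G) :
    (forall u v : G, adj u v -> h v \in nbrs (h u)) ->
  connect (@adj G) x y -> h y \in ball (dist x y) (h x).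
Proof.
move=> nbrsP /dist_walk[p [xp <- <-]].
elim/last_ind: p xp => [|p z IHp]; first by rewrite mem_head.
rewrite rcons_path last_rcons size_rcons => /andP[/IHp yp /nbrsP zp].
rewrite /= mem_undup mem_cat; apply/orP; right.
by apply/flattenP; exists (nbrs (h (last x p))); rewrite ?map_f.
Qed.

End Balls.

Lemma leq_dist_diam (G : sgraph) (x y : G) : dist x y <= diam G.
Proof.
rewrite /diam; apply: leq_trans (leq_bigmax x).
exact: (leq_bigmax (F := fun y => dist x y) y).
Qed.

(** * The tree [T] and its diameter *)

(* The root 0 has children 1, ..., 6, and i = 1, 2, 3 has children 2i+5, 2i+6.
   By convention parent 0 = 0. *)
Definition parent (i : nat) : nat := if i <= 6 then 0 else (i - 5)./2.

(** The positivity guards keep [parent 0 = 0] from making a loop at the root. *)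
Definition tadj (i j : nat) : bool :=
  (0 < i) && (parent i == j) || (0 < j) && (parent j == i).

Lemma parent_child i : i <= 6 -> parent i = 0.
Proof. by rewrite /parent => ->. Qed.

Lemma parent_leaf i : 6 < i -> parent i = (i - 5)./2.
Proof. by rewrite /parent ltnNge => /negPf->. Qed.

Lemma parent_lt i : 0 < i -> parent i < i.
Proof. by rewrite /parent; case: ifP => //; lia. Qed.

Lemma tadj_sym : symmetric tadj.
Proof. by move=> i j; rewrite /tadj orbC. Qed.

Lemma tadj_lt i j : tadj i j -> j < i -> j = parent i.
Proof.
by case/orP=> /andP[gt0 /eqP <-] //; rewrite ltnNge ltnW // parent_lt.
Qed.

Lemma tadj_irr : irreflexive tadj.
Proof.
move=> i; apply/negP => e_ii.
by case/orP: e_ii => /andP[/parent_lt lt_i /eqP pi]; rewrite pi ltnn in lt_i.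
Qed.

Definition T : sgraph :=
  @SGraph 'I_13 (fun i j => tadj i j) (fun i j => tadj_sym i j)
    (fun i => tadj_irr i).

Definition tnbrs (i : nat) : seq nat := filter (tadj i) (iota 0 13).

Lemma tnbrsP (u v : T) : adj u v -> val v \in tnbrs (val u).
Proof. by move=> uv; rewrite mem_filter mem_iota leq0n ltn_ord !andbT. Qed.

Definition vtx (i : nat) : T := inord i.

Lemma vtxK i : i < 13 -> val (vtx i) = i.
Proof. exact: inordK. Qed.

Lemma adj_vtx i j : i < 13 -> j < 13 -> adj (vtx i) (vtx j) = tadj i j.
Proof. by move=> ? ?; rewrite /adj /= !inordK. Qed.

Lemma walk_root (x : T) :
  exists p, [/\ path (@adj T) x p, last x p = vtx 0 & size p <= 2].
Proof.
have -> : x = vtx (val x) by apply: val_inj; rewrite vtxK ?ltn_ord.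
move: (val x) (ltn_ord x : val x < 13) => i lt_i.
have [-> | i_gt0] := posnP i; first by exists [::].
have [le_i6 | gt_i6] := leqP i 6.
  have e : adj (vtx i) (vtx 0).
    by rewrite adj_vtx // /tadj parent_child // i_gt0.
  by exists [:: vtx 0]; split=> //; apply/andP.
have lt_p := parent_lt i_gt0.
have e1 : adj (vtx i) (vtx (parent i)).
  by rewrite adj_vtx ?(ltn_trans lt_p) // /tadj i_gt0 eqxx.
have e2 : adj (vtx (parent i)) (vtx 0).
  rewrite adj_vtx ?(ltn_trans lt_p) // /tadj (@parent_child (parent i)).
    by rewrite parent_leaf //; lia.
  by rewrite parent_leaf //; lia.
by exists [:: vtx (parent i); vtx 0]; split=> //; apply/and3P.
Qed.

Lemma T_walk (x y : T) :
  exists p, [/\ path (@adj T) x p, last x p = y & size p <= 4].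
Proof.
have [p [xp lp sp]] := walk_root x; have [q [yq lq sq]] := walk_root y.
(* Go up from [x], then down to [y]; [belast] drops the root, which already ends [p]. *)
exists (p ++ rev (belast y q)); rewrite cat_path xp last_cat lp -lq /=; split.
- rewrite rev_path; apply: sub_path yq => u v; by rewrite adj_sym.
- by case: q {yq lq sq} => //= z q; rewrite rev_cons last_rcons.
- by rewrite size_cat size_rev size_belast (leq_add sp sq).
Qed.

Lemma T_connected : connected T.
Proof.
rewrite /connected card_ord /=; apply/'forall_forallP => x y.
by have [p [xp <- _]] := T_walk x y; apply/connectP; exists p.
Qed.

(* The largest vertex of a cycle is adjacent to its two neighbours on the cycle
   only through its parent, so they coincide. *)
Lemma T_acyclic : acyclic T.
Proof.
move=> c /andP[cyc_c Uc]; rewrite leqNgt; apply/negP => gt2.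
have [x0 x0c] : exists x, x \in c.
  by case: c gt2 {cyc_c Uc} => // x c _; exists x; rewrite mem_head.
have [m mc max_m] := @arg_maxnP T x0 (fun x => x \in c) (fun x => val x) x0c.
have [i c' def_c] := rot_to mc.
move: cyc_c Uc gt2; rewrite -(rot_cycle i) -(rot_uniq i) -(size_rot i) def_c.
have {max_m} le_m x : x \in m :: c' -> val x <= val m.
  by rewrite -def_c mem_rot; apply: max_m.
case: c' {def_c} le_m => // x c'; case/lastP: c' => // c' y le_m.
rewrite /= rcons_path last_rcons => /and3P[mx _ ym].
rewrite !inE mem_rcons !inE !negb_or -!andbA => /and5P[m'x m'y _ x'y _] _.
have xm : val x < val m.
  by rewrite ltn_neqAle le_m ?inE ?eqxx ?orbT // andbT eq_sym.
have ym' : val y < val m.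
  by rewrite ltn_neqAle le_m ?inE ?mem_rcons ?inE ?eqxx ?orbT // andbT eq_sym.
case/negP: x'y; rewrite mem_rcons inE; apply/orP; left; apply/eqP/val_inj.
rewrite tadj_sym in ym.
exact: etrans (tadj_lt mx xm) (esym (tadj_lt ym ym')).
Qed.

Lemma diam_T : diam T = 4.
Proof.
apply/eqP; rewrite eqn_leq; apply/andP; split.
  apply/bigmax_leqP => x _; apply/bigmax_leqP => y _.
  have [p [xp <- sp]] := T_walk x y; exact: leq_trans (dist_le_walk xp) sp.
(* 7 and 9 hang from the distinct children 1 and 2; evaluation shows that the ball of radius 3
   around 7 misses 9. *)
apply: leq_trans (leq_dist_diam (vtx 7) (vtx 9)).
rewrite leqNgt ltnS; apply/negP => le3.
have /andP[_ /'forall_forallP/(_ (vtx 7) (vtx 9)) c79] := T_connected.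
have := sub_ball le3 (mem_ball_dist tnbrsP c79).
by rewrite !vtxK.
Qed.

(** * Upper bound on the local density *)

(** The side conditions exclude balls that are too large: at radius 1 the root has 7 vertices in its
    ball, and at radius 2 vertex 1 has 9. *)
Lemma size_ball_T k x : k < 4 -> 0 < x < 13 -> (6 < x) || (k < 2) ->
  size (ball tnbrs k x) <= (3 * k).+1.
Proof.
have /allP chk : all (fun k => all (fun x =>
    (6 < x) || (k < 2) ==> (size (ball tnbrs k x) <= (3 * k).+1))
  (iota 1 12)) (iota 0 4) by vm_compute.
move=> lt_k lt_x; apply: implyP; move: x lt_x; have := chk k.
by rewrite mem_iota => /(_ lt_k)/allP + x lt_x; apply; rewrite mem_iota.
Qed.

Lemma card_ord_sub n (S : {set 'I_n}) (s : seq nat) :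
  (forall x, x \in S -> val x \in s) -> #|S| <= size s.
Proof.
move=> sub; rewrite cardE -(size_map val); apply: uniq_leq_size.
  by rewrite (map_inj_uniq val_inj) enum_uniq.
by move=> _ /mapP[x + ->]; rewrite mem_enum; apply: sub.
Qed.

(** Any vertex of [H] may serve as centre of a ball containing [H], so one with a small ball is
    chosen: a vertex other than the root if the diameter is below 2, a vertex above 6 if it is 2 or
    3. *)
Lemma card_subgraph_T (H : subgraph T) :
  connected H -> 1 < #|{: H}| -> #|{: H}| <= (3 * diam H).+1.
Proof.
case/andP=> _ /'forall_forallP conH; rewrite card_sig.
pose S := (val H).1; rewrite (eq_card (B := S)) // => gt1.
have near x y : x \in S -> y \in S -> val y \in ball tnbrs (diam H) (val x).
  move=> Sx Sy; pose h (u : H) := val (val u).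
  apply: (sub_ball (leq_dist_diam (Sub x Sx : H) (Sub y Sy : H))).
  apply: (mem_ball_dist (h := h)) (conH _ _) => u v /sub_adjP[uv _].
  exact: tnbrsP uv.
move: (diam H) near => k near.
(* From diameter 4 on, all 13 = 3 * 4 + 1 vertices are allowed. *)
have [k_ge4 | k_lt4] := leqP 4 k.
  by apply: leq_trans (max_card _) _; rewrite card_ord; lia.
have bound x : x \in S -> 0 < val x -> (6 < val x) || (k < 2) ->
    #|S| <= (3 * k).+1.
  move=> Sx x_gt0 x_k.
  have x_lt : 0 < val x < 13 by rewrite x_gt0 ltn_ord.
  apply: leq_trans (size_ball_T k_lt4 x_lt x_k).
  by apply: card_ord_sub => y; apply: near.
have [k_lt2 | k_ge2] := ltnP k 2.
  have [x Sx x'0] : exists2 x, x \in S & x != vtx 0.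
    have /card_gt0P[x] : 0 < #|S :\ vtx 0|.
      by move: gt1; rewrite (cardsD1 (vtx 0)); case: (_ \in _); lia.
    by rewrite !inE => /andP[x'0 Sx]; exists x.
  apply: (bound x) => //; last by rewrite k_lt2 orbT.
  rewrite lt0n; apply: contraNneq x'0 => x_0.
  by apply/eqP/val_inj; rewrite x_0 vtxK.
have [x /andP[Sx x_gt6] | no_leaf] := pickP [pred x in S | 6 < val x].
  by apply: (bound x); rewrite ?x_gt6 //; lia.
(* Only the root and its children remain, and 7 = 3 * 2 + 1. *)
have : #|S| <= size (iota 0 7).
  apply: card_ord_sub => x Sx; rewrite mem_iota /=.
  by have := no_leaf x; rewrite /= Sx /= => /negbT; rewrite -leqNgt.
by rewrite size_iota; lia.
Qed.

Lemma absz_ceil_ratio_le (m n d : nat) : 0 < d -> n <= m * d ->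
  `|Num.ceil (n%:R / d%:R : rat)%R|%N <= m.
Proof.
move=> d_gt0 le_n; set q := (_ / _)%R.
have q_ge0 : (0 <= q)%R by rewrite divr_ge0 ?ler0n.
have q_le : (q <= m%:~R)%R.
  by rewrite ler_pdivrMr ?ltr0n // -natrM ler_nat.
have c_ge0 : (0 <= Num.ceil q)%R by rewrite -(ceil0 rat) le_ceil.
have : (Num.ceil q <= m)%R by rewrite ceil_le_int.
lia.
Qed.

Lemma local_density_T : local_density T <= 3.
Proof.
apply/bigmax_leqP => /= H /andP[conH gt1].
have le_n := card_subgraph_T conH gt1.
apply: absz_ceil_ratio_le; last by rewrite leq_subLR add1n.
rewrite lt0n; apply: contraTneq gt1 => d0.
by rewrite d0 in le_n; rewrite -leqNgt.
Qed.

(** * Lower bound on the bandwidth, by counting positions *)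

Lemma size_le_interval (V : eqType) (f : V -> int) (s : seq V) (a : int) n :
    injective f -> uniq s ->
    (forall x, x \in s -> (a <= f x)%R && (f x < a + n%:Z)%R) ->
  size s <= n.
Proof.
move=> f_inj Us f_s; pose h x := `|f x - a|%N.
rewrite -(size_map h) -[leqRHS](size_iota 0); apply: uniq_leq_size.
  rewrite map_inj_in_uniq // => x y /f_s fx /f_s fy; rewrite /h => hxy.
  apply: f_inj; lia.
by move=> _ /mapP[x /f_s fx ->]; rewrite mem_iota /h; lia.
Qed.

Lemma uniq_vtx s : all (ltn^~ 13) s -> uniq s -> uniq (map vtx s).
Proof.
move=> /allP s13 Us; rewrite map_inj_in_uniq // => i j /s13 lti /s13 ltj.
by move/(congr1 val); rewrite !vtxK.
Qed.

Section ShortEdges.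

Variable f : T -> int.
Hypothesis f_inj : injective f.
Hypothesis f_short : forall u v : T, adj u v -> `|(f u - f v)%R|%N <= 3.

Lemma f_short_vtx i j : i < 13 -> j < 13 -> tadj i j ->
  `|(f (vtx i) - f (vtx j))%R|%N <= 3.
Proof. by move=> lti ltj eij; apply: f_short; rewrite adj_vtx. Qed.

Lemma leaf_far i : 6 < i < 13 -> 3 < `|(f (vtx i) - f (vtx 0))%R|%N.
Proof.
case/andP=> i_gt6 i_lt; rewrite ltnNge; apply/negP => near_i.
(* Otherwise eight vertices share the seven positions within 3 of the root. *)
suff: size (map vtx (i :: iota 0 7)) <= 7 by rewrite size_map.
apply: (size_le_interval (a := f (vtx 0) - 3)) f_inj _ _ => [|x].
  by apply: uniq_vtx => //=; rewrite ?i_lt // !inE; lia.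
case/mapP=> j; rewrite inE => /predU1P[-> ->|]; first by lia.
rewrite mem_iota /= => j_lt ->.
suff: `|(f (vtx j) - f (vtx 0))%R|%N <= 3 by lia.
have [->|j_gt0] := posnP j; first by rewrite subrr.
by apply: f_short_vtx; rewrite /tadj ?parent_child //; lia.
Qed.

Lemma not_two_right i j : 0 < i -> i < j -> j < 4 ->
  (f (vtx 0) < f (vtx i))%R -> (f (vtx 0) < f (vtx j))%R -> False.
Proof.
move=> i_gt0 lt_ij j_lt4 fi fj.
pose s := [:: i.*2 + 5; i.*2 + 6; j.*2 + 5; j.*2 + 6].
suff: size (map vtx s) <= 3 by rewrite size_map.
apply: (size_le_interval (a := f (vtx 0) + 4)) f_inj _ _ => [|x].
  by apply: uniq_vtx; rewrite /= ?inE; lia.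
(* Two short edges put the leaf at most 6 to the right of the root. Its parent being to the right,
   it is at most 2 to the left, so [leaf_far] leaves only the offsets 4, 5 and 6. *)
have leafP l k : 6 < l < 13 -> parent l = k -> 0 < k < 4 ->
    (f (vtx 0) < f (vtx k))%R ->
  (f (vtx 0) + 4 <= f (vtx l))%R && (f (vtx l) < f (vtx 0) + 4 + 3%:Z)%R.
  move=> l_leaf pl k_child fk; have := leaf_far l_leaf.
  have : `|(f (vtx l) - f (vtx k))%R|%N <= 3.
    by apply: f_short_vtx; rewrite /tadj ?pl ?eqxx; lia.
  have : `|(f (vtx k) - f (vtx 0))%R|%N <= 3.
    by apply: f_short_vtx; rewrite /tadj ?parent_child; lia.
  lia.
rewrite /s /= !inE.
by case/or4P=> /eqP->; [apply: (leafP _ i)|apply: (leafP _ i)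
  |apply: (leafP _ j)|apply: (leafP _ j)]; rewrite ?parent_leaf //; lia.
Qed.

End ShortEdges.

Lemma bandwidth_T : 3 < bandwidth T.
Proof.
rewrite /bandwidth; case: ex_minnP => b /asboolP[f [f_inj <-]] _.
rewrite ltnNge; apply/negP => le3.
have f_short (u v : T) : adj u v -> `|(f u - f v)%R|%N <= 3.
  move=> uv; apply: leq_trans le3; apply: leq_trans (leq_bigmax u).
  exact: (leq_bigmax_cond (F := fun v => `|(f u - f v)%R|%N)).
(* Reflection preserves edge lengths and turns the left side of the root into the right side. *)
pose g v := (- f v)%R.
have g_inj : injective g by move=> u v /oppr_inj/f_inj.
have g_short (u v : T) : adj u v -> `|(g u - g v)%R|%N <= 3.
  by move=> /f_short; rewrite /g; lia.
have side i : 0 < i < 4 ->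
    (f (vtx 0) < f (vtx i))%R \/ (g (vtx 0) < g (vtx i))%R.
  move=> i_bd; have : f (vtx i) != f (vtx 0).
    by rewrite (inj_eq f_inj) -(inj_eq val_inj) /= !vtxK //; lia.
  rewrite /g; lia.
have fR := not_two_right f_inj f_short; have gR := not_two_right g_inj g_short.
by case: (side 1) => // s1; case: (side 2) => // s2; case: (side 3) => // s3;
  first [exact: (fR 1 2) | exact: (fR 1 3) | exact: (fR 2 3)
        |exact: (gR 1 2) | exact: (gR 1 3) | exact: (gR 2 3)].
Qed.

Theorem theorem2 :
  exists T : sgraph, [/\ tree T, diam T = 4 & local_density T < bandwidth T].
Proof.
exists T; split; first by split; [exact: T_connected | exact: T_acyclic].
  exact: diam_T.
exact: leq_ltn_trans local_density_T bandwidth_T.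
Qed.
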